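(* Let $(H,R)$ be a factorizable Hopf algebra and let $G$ be a subgroup of $G(H)\cap Z(H)$. Then $(H/H(\Bbbk G)^+,\overline R)$ is a factorizable Hopf algebra if and only if the matrix $[(\Phi_R^{-1}(g))(h)]_{g,h\in G}$ is non-degenerate, where $\overline R=(\pi\otimes\pi)(R)$ for the natural quotient map $\pi:H\to H/H(\Bbbk G)^+$.
   Context: All Hopf algebras are finite-dimensional over an algebraically closed field $\Bbbk$ of characteristic $0$. $G(H)$ is the group of group-like elements and $Z(H)$ the center of $H$. $(\Bbbk G)^+$ is the kernel of the counit on the group algebra $\Bbbk G\subseteq H$. A quasitriangular Hopf algebra is $(H,R)$ with $R\in H\otimes H$ invertible, $(\Delta\otimes\mathrm{Id})(R)=R_{13}R_{23}$, $(\mathrm{Id}\otimes\Delta)(R)=R_{13}R_{12}$, $\Delta^{op}(h)R=R\Delta(h)$ for $h\in H$. Put $\Phi_R:H^*\to H$, $\Phi_R(a)=(a\otimes\mathrm{Id})(R_{21}R)$. The pair $(H,R)$ is factorizable if $\Phi_R$ is a linear isomorphism. *)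

(* Defs.v *)
From HB Require Import structures.
From mathcomp Require Import all_boot all_order all_algebra all_field.
From mathcomp Require Import finmap.

Set Implicit Arguments.
Unset Strict Implicit.
Unset Printing Implicit Defensive.

Import GRing.Theory.
Import VectorInternalTheory.
Local Open Scope ring_scope.

Reserved Notation "u ⊗ v" (at level 40, left associativity).

(* An element of the tensor product is the matrix of its coordinates on the
   products of the canonical basis vectors of the two factors.  The universal
   property is given by [tlift], [tliftE] and [tlift_unique]. *)

Section TensorDef.
Variables (k : fieldType) (U V : vectType k).

Definition tensor : Type := 'M[k]_(dim U, dim V).
HB.instance Definition _ := Vector.copy tensor 'M[k]_(dim U, dim V).

Definition tens (u : U) (v : V) : tensor := (v2r u)^T *m v2r v.

Definition vcan (W : vectType k) (i : 'I_(dim W)) : W := r2v (delta_mx 0 i).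

(* The map [u ⊗ v |-> f u v]; this is only meaningful for bilinear [f]. *)
Definition tlift (W : lmodType k) (f : U -> V -> W) (t : tensor) : W :=
  \sum_i \sum_j (t : 'M_(_, _)) i j *: f (vcan i) (vcan j).

Definition bilin (W : lmodType k) (f : U -> V -> W) : Prop :=
  (forall v, linear (f^~ v)) /\ (forall u, linear (f u)).

End TensorDef.

Notation "U ⊗ V" := (tensor U%type V%type) : type_scope.
Notation "u ⊗ v" := (tens u v) : ring_scope.

Section TensorTheory.
Variable k : fieldType.
Implicit Types (U V W X : vectType k).

Lemma vcan_sum U (u : U) : u = \sum_i v2r u 0 i *: vcan i.
Proof.
apply: v2r_inj; rewrite linear_sum {1}[v2r u]row_sum_delta.
by apply: eq_bigr => i _; rewrite linearZ /= /vcan r2vK.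
Qed.

Lemma tensPl U V (v : V) : linear (fun u : U => u ⊗ v).
Proof. by move=> a x y; rewrite /tens !linearP /= mulmxDl -scalemxAl. Qed.
Lemma tensPr U V (u : U) : linear (fun v : V => u ⊗ v).
Proof. by move=> a x y; rewrite /tens !linearP. Qed.

Lemma tens0l U V (v : V) : (0 : U) ⊗ v = 0.
Proof. by rewrite /tens linear0 trmx0 mul0mx. Qed.

Lemma tens_bilin U V : bilin (@tens k U V).
Proof. by split; [exact: tensPl | exact: tensPr]. Qed.

Lemma tlift_linear U V (W : lmodType k) (f : U -> V -> W) : linear (tlift f).
Proof.
move=> a s t; rewrite /tlift scaler_sumr -big_split; apply: eq_bigr => i _ /=.
rewrite scaler_sumr -big_split; apply: eq_bigr => j _ /=.
by rewrite 2!mxE scalerDl scalerA.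
Qed.
HB.instance Definition _ U V (W : lmodType k) (f : U -> V -> W) :=
  GRing.isSemilinear.Build k (U ⊗ V)%type W _ (tlift f)
    (GRing.semilinear_linear (tlift_linear f)).

Lemma lin_sum (U W : lmodType k) (f : U -> W) : linear f ->
  forall (I : Type) (r : seq I) (c : I -> k) (F : I -> U),
    f (\sum_(i <- r) c i *: F i) = \sum_(i <- r) c i *: f (F i).
Proof.
move=> lf I r c F; have f0 : f 0 = 0.
  by have := lf (-1) 0 0; rewrite scaler0 addr0 scaleN1r addNr.
by elim/big_rec2: _ => [|i x y _ <-]; rewrite ?f0 // lf.
Qed.

Lemma tliftE U V (W : lmodType k) (f : U -> V -> W) u v :
  bilin f -> tlift f (u ⊗ v) = f u v.
Proof.
case=> fl fr; rewrite {2}[u]vcan_sum (lin_sum (fl v)).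
apply: eq_bigr => i _; rewrite {2}[v]vcan_sum (lin_sum (fr _)) scaler_sumr.
by apply: eq_bigr => j _; rewrite scalerA !mxE big_ord1 !mxE.
Qed.

Lemma tens_sum U V (t : U ⊗ V) :
  t = \sum_i \sum_j (t : 'M_(_, _)) i j *: (vcan i ⊗ vcan j).
Proof.
rewrite {1}[t]matrix_sum_delta; apply: eq_bigr => i _; apply: eq_bigr => j _.
congr (_ *: _); apply/matrixP=> x y; rewrite !mxE big_ord1 /vcan !r2vK !mxE.
by rewrite /= -natrM mulnb.
Qed.

Lemma tens_ind U V (P : U ⊗ V -> Prop) :
  (forall u v, P (u ⊗ v)) -> (forall s t, P s -> P t -> P (s + t)) ->
  forall t, P t.
Proof.
move=> Pp Pa t; have P0 : P 0.
  by rewrite -(tens0l U (0 : V)).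
rewrite [t]tens_sum; elim/big_ind: _ => // i _; elim/big_ind: _ => // j _.
have := tensPl (vcan j) (t i j) (vcan i) 0.
by rewrite /= tens0l !addr0 => <-.
Qed.

Lemma tlift_unique U V (W : lmodType k) (f g : {linear (U ⊗ V)%type -> W}) :
  (forall u v, f (u ⊗ v) = g (u ⊗ v)) -> f =1 g.
Proof. by move=> fg; elim/tens_ind=> // s t; rewrite !linearD => -> ->. Qed.

Lemma tlift_param U V (X W : lmodType k) (g : X -> U -> V -> W) t :
  (forall u v, linear (fun x => g x u v)) -> linear (fun x => tlift (g x) t).
Proof.
move=> gl a x y; rewrite /tlift scaler_sumr -big_split; apply: eq_bigr => i _.
rewrite scaler_sumr -big_split; apply: eq_bigr => j _ /=.
by rewrite gl scalerDr !scalerA [_ * a]mulrC.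
Qed.

Lemma eq_tlift U V (W : lmodType k) (f g : U -> V -> W) t :
  (forall u v, f u v = g u v) -> tlift f t = tlift g t.
Proof. by move=> fg; do 2!apply: eq_bigr => ? _; rewrite fg. Qed.

Definition tmap U U' V V' (f : U -> U') (g : V -> V') : U ⊗ V -> U' ⊗ V' :=
  tlift (fun u v => f u ⊗ g v).
Definition tswap U V : U ⊗ V -> V ⊗ U := tlift (fun u v => v ⊗ u).
Definition tassoc U V W : U ⊗ (V ⊗ W) -> (U ⊗ V) ⊗ W :=
  tlift (fun u => tlift (fun v w => u ⊗ v ⊗ w)).

HB.instance Definition _ U U' V V' f g :=
  GRing.Linear.on (@tmap U U' V V' f g).
HB.instance Definition _ U V := GRing.Linear.on (@tswap U V).
HB.instance Definition _ U V W := GRing.Linear.on (@tassoc U V W).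

Lemma tmap_bilin U U' V V' (f : {linear U -> U'}) (g : {linear V -> V'}) :
  bilin (fun u v => f u ⊗ g v).
Proof. by split=> [v|u] a x y; rewrite linearP ?tensPl ?tensPr. Qed.

Lemma tmapE U U' V V' (f : {linear U -> U'}) (g : {linear V -> V'}) u v :
  tmap f g (u ⊗ v) = f u ⊗ g v.
Proof. exact: tliftE (tmap_bilin f g). Qed.

Lemma tswapE U V (u : U) (v : V) : tswap (u ⊗ v) = v ⊗ u.
Proof. by apply: tliftE; split=> [w|w] a x y; rewrite ?tensPl ?tensPr. Qed.

Lemma tassocE U V W (u : U) (v : V) (w : W) :
  tassoc (u ⊗ (v ⊗ w)) = u ⊗ v ⊗ w.
Proof.
rewrite /tassoc tliftE; last first.
  split=> [t|x]; last exact: tlift_linear.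
  by apply: tlift_param => v' w' a x y; rewrite !tensPl.
by apply: tliftE; split=> [y|y] a x z; rewrite ?(tensPl, tensPr).
Qed.

End TensorTheory.

Section TensorAlgebra.
Variables (k : fieldType) (A B : falgType k).
Implicit Types (s t : A ⊗ B).

(* [(a ⊗ b) * (c ⊗ d) = (a * c) ⊗ (b * d)] *)
Definition tone : A ⊗ B := 1 ⊗ 1.
Definition tmul s t : A ⊗ B :=
  tlift (fun a b => tlift (fun c d => (a * c) ⊗ (b * d)) t) s.

Fact tmulPl t : linear (tmul^~ t).
Proof. exact: tlift_linear. Qed.
Fact tmulPr s : linear (tmul s).
Proof. by apply: tlift_param => a b; apply: tlift_linear. Qed.

Fact tmulE a b c d : tmul (a ⊗ b) (c ⊗ d) = (a * c) ⊗ (b * d).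
Proof.
rewrite /tmul tliftE; last first.
  split=> [y|y]; apply: tlift_param => u v e x z.
    by rewrite mulrDl -scalerAl tensPl.
  by rewrite mulrDl -scalerAl tensPr.
by apply: tliftE; split=> [y|y] e x z; rewrite mulrDr -scalerAr ?tensPl ?tensPr.
Qed.

Fact tmulDl : left_distributive tmul +%R.
Proof. by move=> s s' t; have := tmulPl t 1 s s'; rewrite !scale1r. Qed.
Fact tmulDr : right_distributive tmul +%R.
Proof. by move=> t s s'; have := tmulPr t 1 s s'; rewrite !scale1r. Qed.
Fact tmulA : associative tmul.
Proof.
elim/tens_ind=> [a b|s s' IH IH'] t u; last by rewrite !tmulDl IH IH'.
elim/tens_ind: t => [c d|s s' IH IH']; last by rewrite !(tmulDl, tmulDr) IH IH'.
elim/tens_ind: u => [e f|s s' IH IH']; last by rewrite !tmulDr IH IH'.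
by rewrite !tmulE !mulrA.
Qed.
Fact tmul1 : left_id tone tmul.
Proof.
by elim/tens_ind=> [a b|s s' IH IH']; rewrite ?tmulE ?mul1r // tmulDr IH IH'.
Qed.
Fact tmulr1 : right_id tone tmul.
Proof.
by elim/tens_ind=> [a b|s s' IH IH']; rewrite ?tmulE ?mulr1 // tmulDl IH IH'.
Qed.
Fact tone_neq0 : tone != 0.
Proof.
have nz (W : falgType k) : exists i, v2r (1 : W) 0 i != 0.
  have: v2r (1 : W) != 0 by rewrite -(inj_eq (@r2v_inj _ W)) v2rK linear0 oner_eq0.
  by case/rV0Pn=> i; exists i.
have [[i nzi] [j nzj]] := (nz A, nz B).
apply/eqP=> /matrixP/(_ i j)/eqP; rewrite !mxE big_ord1 !mxE mulf_eq0.
by rewrite (negPf nzi) (negPf nzj).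
Qed.
HB.instance Definition _ := GRing.Zmodule_isNzRing.Build (A ⊗ B)%type
  tmulA tmul1 tmulr1 tmulDl tmulDr tone_neq0.
Fact tscalerAl (a : k) s t : a *: (s * t) = (a *: s) * t.
Proof. by have := tmulPl t a s 0; rewrite !addr0 /tmul linear0 addr0. Qed.
HB.instance Definition _ :=
  GRing.Lmodule_isLalgebra.Build k (A ⊗ B)%type tscalerAl.
Fact tscalerAr (a : k) s t : a *: (s * t) = s * (a *: t).
Proof.
have s0 : tmul s 0 = 0 by apply: (mulr0 (s : A ⊗ B)).
by have := tmulPr s a t 0; rewrite s0 !addr0.
Qed.
HB.instance Definition _ :=
  GRing.Lalgebra_isAlgebra.Build k (A ⊗ B)%type tscalerAr.
HB.instance Definition _ := Algebra_isFalgebra.Build k (A ⊗ B)%type.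

Lemma tensM a b c d : (a ⊗ b) * (c ⊗ d) = (a * c) ⊗ (b * d) :> A ⊗ B.
Proof. exact: tmulE. Qed.
Lemma tens1 : 1 ⊗ 1 = 1 :> A ⊗ B. Proof. by []. Qed.

End TensorAlgebra.

HB.mixin Record Falgebra_isHopf (k : fieldType) H of Falgebra k H := {
  comul : 'Hom(H, (H ⊗ H)%type);
  counit : 'Hom(H, k^o);
  antipode : 'End(H);
  comulA : forall h : H,
    tassoc (tmap idfun comul (comul h)) = tmap comul idfun (comul h);
  counit_comul : forall h : H, tlift (fun x y => counit x *: y) (comul h) = h;
  comul_counit : forall h : H, tlift (fun x y => counit y *: x) (comul h) = h;
  comul1 : comul 1 = 1;
  comulM : {morph comul : x y / x * y};
  counit1 : counit 1 = 1;
  counitM : {morph counit : x y / x * y};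
  antipode_comul : forall h : H,
    tlift (fun x y => antipode x * y) (comul h) = (counit h)%:A;
  comul_antipode : forall h : H,
    tlift (fun x y => x * antipode y) (comul h) = (counit h)%:A
}.

#[short(type="hopfAlgType")]
HB.structure Definition Hopf (k : fieldType) :=
  { H of Falgebra_isHopf k H & Falgebra k H }.

Section Quasitriangular.
Variables (k : fieldType) (H : hopfAlgType k).

(* [R_12], [R_13] and [R_23] in [H ⊗ H ⊗ H] *)
Definition leg12 (R : H ⊗ H) : H ⊗ H ⊗ H := tlift (fun a b => a ⊗ b ⊗ 1) R.
Definition leg13 (R : H ⊗ H) : H ⊗ H ⊗ H := tlift (fun a b => a ⊗ 1 ⊗ b) R.
Definition leg23 (R : H ⊗ H) : H ⊗ H ⊗ H := tlift (fun a b => 1 ⊗ a ⊗ b) R.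

Definition quasitriangular (R : H ⊗ H) : Prop :=
  [/\ R \is a GRing.unit,
      tmap comul idfun R = leg13 R * leg23 R,
      tassoc (tmap idfun comul R) = leg13 R * leg12 R
    & forall h : H, tswap (comul h) * R = R * comul h].

Definition Phi (R : H ⊗ H) : 'Hom('Hom(H, k^o), H) :=
  linfun (fun a : 'Hom(H, k^o) => tlift (fun x y => a x *: y) (tswap R * R)).

Definition factorizable (R : H ⊗ H) : Prop :=
  quasitriangular R /\ bijective (Phi R).

Definition grouplike (g : H) : bool := (comul g == g ⊗ g) && (counit g == 1).

End Quasitriangular.
Arguments grouplike {k H} g.

Lemma PhiE (k : fieldType) (H : hopfAlgType k) (R : H ⊗ H) (a : 'Hom(H, k^o)) :
  Phi R a = tlift (fun x y => a x *: y) (tswap R * R).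
Proof.
pose f (b : 'Hom(H, k^o)) := tlift (fun x y => b x *: y) (tswap R * R).
have lf : linear f.
  apply: tlift_param => u v c x y.
  by rewrite add_lfunE scale_lfunE scalerDl -scalerA.
pose fL : {linear 'Hom(H, k^o) -> H} :=
  HB.pack f (GRing.isSemilinear.Build k 'Hom(H, k^o) H _ f
    (GRing.semilinear_linear lf)).
exact: (lfunE fL).
Qed.

Section QuotientSpace.
Variables (k : fieldType) (V : vectType k) (U : {vspace V}).

(* [V / U], carried by a complement of [U] *)
Definition vquot : Type := subvs_of (U^C)%VS.
HB.instance Definition _ := Vector.copy vquot (subvs_of (U^C)%VS).

Definition vquot_pi : 'Hom(V, vquot) :=
  linfun (vsproj (U^C)%VS \o daddv_pi (U^C)%VS U).
Definition vquot_repr (q : vquot) : V := vsval q.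

Lemma vquot_piE x : vquot_repr (vquot_pi x) = daddv_pi (U^C)%VS U x.
Proof. by rewrite /vquot_pi lfunE /= /vquot_repr vsprojK ?memv_pi. Qed.

Lemma vquot_reprK : cancel vquot_repr vquot_pi.
Proof.
move=> q; apply: val_inj; rewrite -[LHS]/(vquot_repr _) vquot_piE.
by rewrite daddv_pi_id ?subvsP // capvC capv_compl.
Qed.

Lemma vquot_repr_pi x : x - vquot_repr (vquot_pi x) \in U.
Proof.
rewrite vquot_piE -{1}(@daddv_pi_add _ _ (U^C)%VS U x).
- by rewrite addrAC subrr add0r memv_pi.
- by rewrite capvC capv_compl.
- by rewrite addvC addv_complf memvf.
Qed.

Lemma lker_vquot_pi : lker vquot_pi = U.
Proof.
apply/vspaceP=> x; rewrite memv_ker; apply/eqP/idP=> [x0|Ux].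
  by have := vquot_repr_pi x; rewrite x0 subr0.
have := vquot_repr_pi x; rewrite rpredBl // => Uy.
apply: val_inj; apply/eqP; rewrite -memv0 -(capv_compl U) memv_cap.
by rewrite subvsP andbT.
Qed.

Lemma limg_vquot_pi : limg vquot_pi = fullv.
Proof.
apply/vspaceP=> q; rewrite memvf; apply/memv_imgP.
by exists (vquot_repr q); rewrite ?memvf ?vquot_reprK.
Qed.

Lemma vquot_eq x y : x - y \in U -> vquot_pi x = vquot_pi y.
Proof.
by rewrite -{1}lker_vquot_pi memv_ker linearB subr_eq0 => /eqP.
Qed.

End QuotientSpace.

(* As [lker (tmap pi pi) = I ⊗ H + H ⊗ I], the condition [hopf_ideal_comul]
   says that [I] is a coideal. *)
Record is_hopf_ideal (k : fieldType) (H : hopfAlgType k) (I : {vspace H})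
    : Prop := IsHopfIdeal {
  hopf_ideal_mull : forall x y, y \in I -> x * y \in I;
  hopf_ideal_mulr : forall x y, x \in I -> x * y \in I;
  hopf_ideal_comul : forall x, x \in I ->
    tmap (vquot_pi I) (vquot_pi I) (comul x) = 0;
  hopf_ideal_counit : forall x, x \in I -> counit x = 0;
  hopf_ideal_antipode : forall x, x \in I -> antipode x \in I
}.

Structure hopf_ideal (k : fieldType) (H : hopfAlgType k) := HopfIdeal {
  hopf_ideal_val :> {vspace H};
  hopf_idealP : is_hopf_ideal hopf_ideal_val
}.

Section HopfQuotient.
Variables (k : fieldType) (H : hopfAlgType k) (I : hopf_ideal H).
Let IP := hopf_idealP I.

Definition hquot : Type := vquot I.
HB.instance Definition _ := Vector.copy hquot (vquot I).

Definition hquot_pi : 'Hom(H, hquot) := vquot_pi I.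
Local Notation pi := hquot_pi.
Local Notation rep := (@vquot_repr k H I).

Lemma hquot_ind (P : hquot -> Prop) : (forall x, P (pi x)) -> forall q, P q.
Proof. by move=> Ppi q; rewrite -[q](@vquot_reprK k H I). Qed.

Let rep_pi x : x - rep (pi x) \in (I : {vspace H}).
Proof. exact: vquot_repr_pi. Qed.

Fact hquot_factor (W : lmodType k) (f : {linear H -> W}) x :
  (forall y, y \in (I : {vspace H}) -> f y = 0) -> f (rep (pi x)) = f x.
Proof. by move=> /(_ _ (rep_pi x)); rewrite linearB => /subr0_eq. Qed.

Definition hquot_mul (q r : hquot) : hquot := pi (rep q * rep r).
Fact hquot_mulE x y : hquot_mul (pi x) (pi y) = pi (x * y).
Proof.
apply/esym/vquot_eq; have -> : x * y - rep (pi x) * rep (pi y)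
    = (x - rep (pi x)) * y + rep (pi x) * (y - rep (pi y)).
  by rewrite mulrBl mulrBr addrA subrK.
apply: rpredD; first exact/(hopf_ideal_mulr IP)/rep_pi.
exact/(hopf_ideal_mull IP)/rep_pi.
Qed.
Fact hquot_mulA : associative hquot_mul.
Proof.
by elim/hquot_ind=> x; elim/hquot_ind=> y; elim/hquot_ind=> z;
   rewrite !hquot_mulE mulrA.
Qed.
Fact hquot_mul1 : left_id (pi 1) hquot_mul.
Proof. by elim/hquot_ind=> x; rewrite hquot_mulE mul1r. Qed.
Fact hquot_mulr1 : right_id (pi 1) hquot_mul.
Proof. by elim/hquot_ind=> x; rewrite hquot_mulE mulr1. Qed.
Fact hquot_mulDl : left_distributive hquot_mul +%R.
Proof.
elim/hquot_ind=> x; elim/hquot_ind=> y; elim/hquot_ind=> z.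
by rewrite -linearD !hquot_mulE -linearD mulrDl.
Qed.
Fact hquot_mulDr : right_distributive hquot_mul +%R.
Proof.
elim/hquot_ind=> x; elim/hquot_ind=> y; elim/hquot_ind=> z.
by rewrite -linearD !hquot_mulE -linearD mulrDr.
Qed.
Fact hquot_one_neq0 : pi 1 != 0.
Proof.
rewrite -memv_ker lker_vquot_pi; apply/negP=> /(hopf_ideal_counit IP)/eqP.
by rewrite counit1 oner_eq0.
Qed.
HB.instance Definition _ := GRing.Zmodule_isNzRing.Build hquot
  hquot_mulA hquot_mul1 hquot_mulr1 hquot_mulDl hquot_mulDr hquot_one_neq0.

Lemma hquot_piM : {morph pi : x y / x * y}.
Proof. by move=> x y; rewrite -hquot_mulE. Qed.
Lemma hquot_pi1 : pi 1 = 1. Proof. by []. Qed.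

Fact hquot_scalerAl (a : k) (q r : hquot) : a *: (q * r) = (a *: q) * r.
Proof.
elim/hquot_ind: q => x; elim/hquot_ind: r => y.
by rewrite -hquot_piM -!linearZ /= -hquot_piM scalerAl.
Qed.
HB.instance Definition _ :=
  GRing.Lmodule_isLalgebra.Build k hquot hquot_scalerAl.
Fact hquot_scalerAr (a : k) (q r : hquot) : a *: (q * r) = q * (a *: r).
Proof.
elim/hquot_ind: q => x; elim/hquot_ind: r => y.
by rewrite -hquot_piM -!linearZ /= -hquot_piM scalerAr.
Qed.
HB.instance Definition _ :=
  GRing.Lalgebra_isAlgebra.Build k hquot hquot_scalerAr.
HB.instance Definition _ := Algebra_isFalgebra.Build k hquot.

Definition hquot_comul : 'Hom(hquot, (hquot ⊗ hquot)%type) :=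
  linfun (fun q : hquot => tmap pi pi (comul (rep q))).
Definition hquot_counit : 'Hom(hquot, k^o) :=
  linfun (fun q : hquot => counit (rep q)).
Definition hquot_antipode : 'End(hquot) :=
  linfun (fun q : hquot => pi (antipode (rep q))).

Let linfun_pi (W : vectType k) (f : {linear H -> W}) x :
    (forall y, y \in (I : {vspace H}) -> f y = 0) ->
  linfun (fun q : hquot => f (rep q)) (pi x) = f x.
Proof.
move=> fI; pose g (q : hquot) := f (rep q).
have lg : linear g by move=> a u v; rewrite /g -linearP.
pose gL : {linear hquot -> W} :=
  HB.pack g (GRing.isSemilinear.Build k hquot W _ g
    (GRing.semilinear_linear lg)).
by rewrite (lfunE gL) /= /g hquot_factor.
Qed.

Lemma hquot_comulE x : hquot_comul (pi x) = tmap pi pi (comul x).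
Proof.
exact: (@linfun_pi _ (tmap pi pi \o comul) x (hopf_ideal_comul IP)).
Qed.
Lemma hquot_counitE x : hquot_counit (pi x) = counit x.
Proof. exact: (@linfun_pi _ counit x (hopf_ideal_counit IP)). Qed.
Lemma hquot_antipodeE x : hquot_antipode (pi x) = pi (antipode x).
Proof.
apply: (@linfun_pi _ (pi \o antipode) x) => y Iy /=; apply/eqP.
by rewrite -memv_ker lker_vquot_pi (hopf_ideal_antipode IP).
Qed.

Fact tmap_pi1 : tmap pi pi 1 = 1.
Proof. exact: tmapE. Qed.
Fact tmap_piM : {morph tmap pi pi : s t / s * t}.
Proof.
elim/tens_ind=> [a b|s s' IH IH'] t; last by rewrite mulrDl !linearD /= mulrDl IH IH'.
elim/tens_ind: t => [c d|s s' IH IH']; last by rewrite mulrDr !linearD /= mulrDr IH IH'.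
by rewrite tensM !tmapE /= tensM !hquot_piM.
Qed.
Fact tlift_tmap_pi (W : vectType k) (f : hquot -> hquot -> W) t :
  bilin f -> tlift f (tmap pi pi t) = tlift (fun x y => f (pi x) (pi y)) t.
Proof.
move=> bf; elim/tens_ind: t => [x y|s t IH IH']; last by rewrite !linearD /= IH IH'.
rewrite tmapE !tliftE //; case: bf => fl fr.
by split=> [v|u] a z w; rewrite linearP ?fl ?fr.
Qed.

Local Notation pi3 := (tmap (tmap pi pi) pi).
Fact hquot_comulA q :
  tassoc (tmap idfun hquot_comul (hquot_comul q))
  = tmap hquot_comul idfun (hquot_comul q).
Proof.
elim/hquot_ind: q => x; rewrite hquot_comulE.
have -> : tmap hquot_comul idfun (tmap pi pi (comul x))
    = pi3 (tmap comul idfun (comul x)).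
  elim/tens_ind: (comul x) => [a b|s t IH IH']; last by rewrite !linearD /= IH IH'.
  by rewrite !tmapE /= hquot_comulE.
have pi3A s : tassoc (tmap pi (tmap pi pi) s) = pi3 (tassoc s).
  elim/tens_ind: s => [a s|s t IH IH']; last by rewrite !linearD /= IH IH'.
  rewrite tmapE /=; elim/tens_ind: s => [b c|s t IH IH'].
    by rewrite tmapE !tassocE !tmapE /= tmapE.
  have aD (u v : H ⊗ H) : a ⊗ (u + v) = a ⊗ u + a ⊗ v.
    by have := tensPr a 1 u v; rewrite !scale1r.
  have bD u v : pi a ⊗ tmap pi pi (u + v)
      = pi a ⊗ tmap pi pi u + pi a ⊗ tmap pi pi v.
    rewrite linearD; have := tensPr (pi a) 1 (tmap pi pi u) (tmap pi pi v).
    by rewrite !scale1r.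
  by rewrite aD bD !linearD /= IH IH'.
rewrite -comulA -pi3A; congr tassoc.
elim/tens_ind: (comul x) => [a b|s t IH IH']; last by rewrite !linearD /= IH IH'.
by rewrite !tmapE /= hquot_comulE.
Qed.
Fact hquot_counit_comul q :
  tlift (fun x y => hquot_counit x *: y) (hquot_comul q) = q.
Proof.
elim/hquot_ind: q => x; rewrite hquot_comulE tlift_tmap_pi; last first.
  split=> [v|u] a y z /=.
    by rewrite linearP scalerDl -scalerA.
  by rewrite scalerDr !scalerA [_ * a]mulrC.
rewrite -{2}[x]counit_comul /tlift linear_sum; apply: eq_bigr => i _.
rewrite linear_sum; apply: eq_bigr => j _.
by rewrite hquot_counitE [RHS]linearZ; congr (_ *: _); rewrite [RHS]linearZ.
Qed.
Fact hquot_comul_counit q :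
  tlift (fun x y => hquot_counit y *: x) (hquot_comul q) = q.
Proof.
elim/hquot_ind: q => x; rewrite hquot_comulE tlift_tmap_pi; last first.
  split=> [v|u] a y z /=.
    by rewrite scalerDr !scalerA [_ * a]mulrC.
  by rewrite linearP scalerDl -scalerA.
rewrite -{2}[x]comul_counit /tlift linear_sum; apply: eq_bigr => i _.
rewrite linear_sum; apply: eq_bigr => j _.
by rewrite hquot_counitE [RHS]linearZ; congr (_ *: _); rewrite [RHS]linearZ.
Qed.
Fact hquot_comul1 : hquot_comul 1 = 1.
Proof. by rewrite -hquot_pi1 hquot_comulE comul1 tmap_pi1. Qed.
Fact hquot_comulM : {morph hquot_comul : x y / x * y}.
Proof.
elim/hquot_ind=> x; elim/hquot_ind=> y.
by rewrite -hquot_piM !hquot_comulE comulM tmap_piM.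
Qed.
Fact hquot_counit1 : hquot_counit 1 = 1.
Proof. by rewrite -hquot_pi1 hquot_counitE counit1. Qed.
Fact hquot_counitM : {morph hquot_counit : x y / x * y}.
Proof.
elim/hquot_ind=> x; elim/hquot_ind=> y.
by rewrite -hquot_piM !hquot_counitE counitM.
Qed.
Fact hquot_antipode_comul q :
  tlift (fun x y => hquot_antipode x * y) (hquot_comul q)
  = (hquot_counit q)%:A.
Proof.
elim/hquot_ind: q => x; rewrite hquot_comulE hquot_counitE tlift_tmap_pi.
  rewrite -hquot_pi1 -linearZ /= -antipode_comul /tlift linear_sum.
  apply: eq_bigr => i _; rewrite linear_sum; apply: eq_bigr => j _.
  by rewrite hquot_antipodeE linearZ /= hquot_piM.
by split=> [v|u] a y z /=; rewrite ?linearP ?mulrDl ?mulrDr -?scalerAl -?scalerAr.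
Qed.
Fact hquot_comul_antipode q :
  tlift (fun x y => x * hquot_antipode y) (hquot_comul q)
  = (hquot_counit q)%:A.
Proof.
elim/hquot_ind: q => x; rewrite hquot_comulE hquot_counitE tlift_tmap_pi.
  rewrite -hquot_pi1 -linearZ /= -comul_antipode /tlift linear_sum.
  apply: eq_bigr => i _; rewrite linear_sum; apply: eq_bigr => j _.
  by rewrite hquot_antipodeE linearZ /= hquot_piM.
by split=> [v|u] a y z /=; rewrite ?linearP ?mulrDl ?mulrDr -?scalerAl -?scalerAr.
Qed.
HB.instance Definition _ := Falgebra_isHopf.Build k hquot
  hquot_comulA hquot_counit_comul hquot_comul_counit
  hquot_comul1 hquot_comulM hquot_counit1 hquot_counitM
  hquot_antipode_comul hquot_comul_antipode.

End HopfQuotient.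

Section Grouplike.
Variables (k : fieldType) (H : hopfAlgType k).
Implicit Types (g h x y : H).

Lemma counit_grouplike g : grouplike g -> counit g = 1.
Proof. by case/andP=> _ /eqP. Qed.
Lemma comul_grouplike g : grouplike g -> comul g = g ⊗ g.
Proof. by case/andP=> /eqP. Qed.

Lemma mul_bilin (S T : {linear H -> H}) : bilin (fun x y => S x * T y).
Proof.
by split=> [v|u] a x y /=; rewrite linearP ?mulrDl ?mulrDr -?scalerAl -?scalerAr.
Qed.

Lemma grouplike_unit g : grouplike g -> g \is a GRing.unit.
Proof.
move=> gl; apply/unitrP; exists (antipode g).
have := antipode_comul g; have := comul_antipode g.
rewrite comul_grouplike // counit_grouplike // scale1r.
by rewrite (tliftE _ _ (mul_bilin antipode idfun))
           (tliftE _ _ (mul_bilin idfun antipode)).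
Qed.

(* Distinct group-like elements are linearly independent; in particular every
   set of group-like elements is finite. *)
Lemma grouplike_free (s : seq H) : uniq s -> all grouplike s -> free s.
Proof.
elim: s => [|g s IH] /=; first by rewrite nil_free.
case/andP=> gNs us /andP[gl sl]; have fs := IH us sl.
rewrite free_cons fs andbT; apply: contra gNs => gs.
pose n := size s; pose X := in_tuple s; pose c (i : 'I_n) := coord X i g.
have gE : g = \sum_(i < n) c i *: s`_i by apply: (@coord_span _ _ _ X).
have cE (i : 'I_n) : c i *: s`_i = c i *: g.
  pose F (t : H ⊗ H) := tlift (fun x y => (coord X i x : k) *: y) t.
  have bF : bilin (fun x y => (coord X i x : k) *: y).
    split=> [v|u] a x y /=; first by rewrite linearP scalerDl -scalerA.
    by rewrite scalerDr !scalerA mulrC.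
  have : F (comul g) = c i *: g by rewrite comul_grouplike // /F tliftE.
  rewrite {1}gE linear_sum /F linear_sum (bigD1 i) //= big1 => [|j ji].
    rewrite addr0 2!linearZ /= comul_grouplike ?(allP sl) ?mem_nth //.
    by rewrite tliftE // (coord_free i i (fs : free X)) eqxx scale1r.
  rewrite 2!linearZ /= comul_grouplike ?(allP sl) ?mem_nth // tliftE //.
  by rewrite (coord_free j i (fs : free X)) (negPf ji) scale0r scaler0.
have [/existsP[i ci]|] := boolP [exists i, c i != 0].
  by have /(scalerI ci) <- := cE i; rewrite mem_nth.
rewrite negb_exists => /forallP c0; have := counit_grouplike gl.
rewrite gE big1 => [/esym/eqP|i _]; first by rewrite linear0 oner_eq0.
by have := c0 i; rewrite negbK => /eqP ->; rewrite scale0r.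
Qed.

Lemma tlift_mulr (W : vectType k) (f : H -> H -> W) (t : H ⊗ H) a b :
  bilin f -> tlift f (t * (a ⊗ b)) = tlift (fun x y => f (x * a) (y * b)) t.
Proof.
move=> bf; elim/tens_ind: t => [x y|s t IH IH'].
  rewrite tensM !tliftE //; case: bf => fl fr.
  by split=> [v|u] c z w; rewrite mulrDl -scalerAl ?fl ?fr.
by rewrite mulrDl !linearD /= IH IH'.
Qed.

Lemma antipode_unique (T : 'End(H)) :
  (forall x, tlift (fun a b => T a * b) (comul x) = (counit x)%:A) ->
  T =1 antipode.
Proof.
move=> Tinv x.
pose m s (c : H) := tlift (fun a b => T a * b) s * antipode c.
have bm : bilin m.
  by split=> [v|u] a y z; rewrite /m linearP ?mulrDl ?mulrDr -?scalerAl -?scalerAr.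
have bT := mul_bilin T idfun.
have ml : tlift m (tmap comul idfun (comul x)) = antipode x.
  rewrite -{2}[x]counit_comul.
  elim/tens_ind: (comul x) => [a b|s t IH IH']; last first.
    by rewrite !linearD /= IH IH'.
  rewrite tmapE tliftE // /m Tinv -scalerAl mul1r tliftE /= ?linearZ //.
  split=> [v|u] c y z /=; first by rewrite linearP scalerDl -scalerA.
  by rewrite scalerDr !scalerA [_ * c]mulrC.
have mr : tlift m (tassoc (tmap idfun comul (comul x))) = T x.
  rewrite -{2}[x]comul_counit.
  elim/tens_ind: (comul x) => [a b|s t IH IH']; last first.
    by rewrite !linearD /= IH IH'.
  rewrite tmapE /= tliftE; last first.
    split=> [v|u] c y z /=; last by rewrite linearP scalerDl -scalerA.
    by rewrite scalerDr !scalerA [_ * c]mulrC.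
  have -> : tlift m (tassoc (a ⊗ comul b))
      = T a * tlift (fun y z => y * antipode z) (comul b).
    elim/tens_ind: (comul b) => [y z|s t IH IH'].
      rewrite tassocE tliftE // /m !tliftE ?mulrA //.
      exact: (mul_bilin idfun antipode).
    have := tensPr a 1 s t; rewrite /= !scale1r => ->.
    by rewrite !linearD /= IH IH' mulrDr.
  by rewrite comul_antipode -scalerAr [T a * _]mulr1 linearZ.
by rewrite -mr comulA ml.
Qed.

Lemma antipode_mul_central g x : grouplike g -> (forall y, g * y = y * g) ->
  antipode (x * g) = antipode x * g^-1.
Proof.
move=> gl gC; have gU := grouplike_unit gl.
pose T : 'End(H) := (amulr g \o antipode \o amulr g)%VF.
have TE y : T y = antipode (y * g) * g by rewrite /T !comp_lfunE !lfunE.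
apply: (mulIr gU); rewrite mulrVK // -TE; apply: antipode_unique => y.
transitivity (tlift (fun a b => antipode a * b) (comul y * (g ⊗ g))).
  rewrite tlift_mulr; last exact: (mul_bilin antipode idfun).
  by apply: eq_tlift => u v; rewrite TE -mulrA gC.
rewrite -comul_grouplike // -comulM antipode_comul counitM.
by rewrite (counit_grouplike gl) mulr1.
Qed.

(* [G] is a subgroup of the group of group-like elements of [H], contained in
   the center of [H]. *)
Record central_subgroup (G : {fset H}) : Prop := CentralSubgroup {
  central_subgroup1 : 1 \in G;
  central_subgroupM : {in G &, forall g h, g * h \in G};
  central_subgroupV : {in G, forall g, g^-1 \in G};
  central_subgroup_grouplike : {in G, forall g, grouplike g};
  central_subgroup_center : {in G, forall g, g \in 'Z({:H})%VS}
}.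

(* [H (kG)^+] *)
Definition aug_ideal (G : {fset H}) : {vspace H} :=
  ({:H} * (<<enum_fset G>> :&: lker counit))%VS.

Section AugIdeal.
Variables (G : {fset H}) (hG : central_subgroup G).

Let gl g : g \in G -> grouplike g := @central_subgroup_grouplike _ hG g.
Let gC g : g \in G -> forall y, g * y = y * g.
Proof.
move=> Gg y; have := central_subgroup_center hG Gg.
by rewrite memv_cap => /andP[_ /centvP]; apply; apply: memvf.
Qed.

Lemma mem_aug_ideal g x : g \in G -> x * g - x \in aug_ideal G.
Proof.
move=> Gg; rewrite -{2}[x]mulr1 -mulrBr memv_mul ?memvf // memv_cap.
rewrite memv_ker linearB /= counit1 counit_grouplike ?gl // subrr eqxx andbT.
by rewrite rpredB ?memv_span ?(central_subgroup1 hG).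
Qed.

Lemma aug_ideal_sub (W : {vspace H}) :
  (forall g x, g \in G -> x * g - x \in W) -> (aug_ideal G <= W)%VS.
Proof.
move=> GW; apply/prodvP=> x y _; rewrite memv_cap memv_ker => /andP[Gy /eqP y0].
have yE := @coord_span _ _ _ (in_tuple (enum_fset G)) y Gy.
set c := fun i => coord (in_tuple (enum_fset G)) i y in yE.
have Gnth (i : 'I_(size (enum_fset G))) : (enum_fset G)`_i \in G.
  exact: mem_nth.
have c0 : \sum_i c i = 0.
  rewrite -[RHS]y0 yE linear_sum [RHS](eq_bigr c) // => i _.
  by rewrite linearZ /= counit_grouplike ?gl // [_ *: _]mulr1.
have -> : x * y = \sum_i c i *: (x * (enum_fset G)`_i - x).
  rewrite (eq_bigr _ (fun i _ => scalerBr _ _ _)) sumrB -scaler_suml c0 scale0r.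
  rewrite subr0 [in LHS]yE mulr_sumr.
  by apply: eq_bigr => i _; rewrite -scalerAr.
by apply: memv_suml => i _; rewrite memvZ ?GW.
Qed.

Lemma aug_ideal_hopf : is_hopf_ideal (aug_ideal G).
Proof.
split=> x.
- suff /subvP sW : (aug_ideal G <= amull x @^-1: aug_ideal G)%VS.
    by move=> y /sW; rewrite -memv_preim lfunE.
  apply: aug_ideal_sub => g y Gg; rewrite -memv_preim lfunE /= mulrBr mulrA.
  exact: mem_aug_ideal.
- move=> y; suff /subvP sW : (aug_ideal G <= amulr y @^-1: aug_ideal G)%VS.
    by move=> /sW; rewrite -memv_preim lfunE.
  apply: aug_ideal_sub => g z Gg; rewrite -memv_preim lfunE /= mulrBl -mulrA (gC Gg).
  by rewrite mulrA mem_aug_ideal.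
- set pi := vquot_pi _.
  pose f : 'Hom(H, (vquot (aug_ideal G) ⊗ vquot (aug_ideal G))%type) :=
    linfun (tmap pi pi \o comul).
  have fE y : f y = tmap pi pi (comul y) by rewrite lfunE.
  suff /subvP sW : (aug_ideal G <= lker f)%VS.
    by move=> /sW; rewrite memv_ker fE => /eqP.
  apply: aug_ideal_sub => g y Gg; rewrite memv_ker linearB /= subr_eq0 !fE.
  rewrite comulM (comul_grouplike (gl Gg)) /tmap tlift_mulr; last exact: tmap_bilin.
  apply/eqP/eq_tlift => u v.
  by congr (_ ⊗ _); apply/vquot_eq/mem_aug_ideal.
- suff /subvP sW : (aug_ideal G <= lker counit)%VS.
    by move=> /sW; rewrite memv_ker => /eqP.
  apply: aug_ideal_sub => g y Gg; rewrite memv_ker linearB /= counitM.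
  by rewrite (counit_grouplike (gl Gg)) mulr1 subrr.
- suff /subvP sW : (aug_ideal G <= antipode @^-1: aug_ideal G)%VS.
    by move=> /sW; rewrite -memv_preim.
  apply: aug_ideal_sub => g y Gg; rewrite -memv_preim linearB /=.
  rewrite antipode_mul_central ?gl //; last exact: gC.
  exact/mem_aug_ideal/(central_subgroupV hG).
Qed.

Definition aug_hopf_ideal : hopf_ideal H := HopfIdeal aug_ideal_hopf.

End AugIdeal.

(* The matrix [(Phi_R^-1 (g)) (h)], with [g] and [h] ranging over [G]. *)
Definition Phi_matrix (R : H ⊗ H) (G : {fset H}) : 'M[k]_#|{: G}| :=
  \matrix_(i, j) (Phi R)^-1%VF (val (enum_val i)) (val (enum_val j)).

End Grouplike.

(* Main.v *)
Require Import Defs.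
From HB Require Import structures.
From mathcomp Require Import all_boot all_order all_algebra all_field.
From mathcomp Require Import finmap.

Set Implicit Arguments.
Unset Strict Implicit.
Unset Printing Implicit Defensive.

Import GRing.Theory.
Local Open Scope ring_scope.

(** Write [Q = R_21 R] and [chi g = Phi_R^-1 g] for [g] in [G], and let [I] be the
    ideal [H (kG)^+].  A functional on [H / I] is a functional on [H] vanishing on
    [I], that is, one invariant under translation by [G], and the Drinfeld map of
    the quotient is [Phi_R] followed by the projection.  By dimensions, and as the
    quotient inherits the axioms on [R], it is factorizable if and only if no
    nonzero [G]-invariant [a] has [Phi_R a] in [I] ([quasitriangular_hquot],
    [Phi_hquot_bijP]).

    Two facts control [chi] on the central subgroup [G].  The coproduct formulas
    [(Delta ⊗ id) Q = R_32 Q_13 R_23] and [(id ⊗ Delta) Q = R_21 Q_13 R_12], when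
    a functional slices the middle [Q_13] to a central element, collapse to that
    element times [Q].  From the first one, [Phi_R (chi g * a) = g Phi_R a] for
    the convolution product ([Phi_hit]).  From the second one,
    [chi g (h x) = chi g h * chi g x] for [h] in [G] ([PhiV_mull]).  Thus
    [(g, h) |-> chi g h] is a bicharacter of [G].

    If the matrix is invertible, [a] is [G]-invariant and [Phi_R a] is in [I],
    then the sum of [G] kills [Phi_R a], so [\sum_g chi g * a = 0]; evaluation at
    [h x] gives [\sum_g chi g h (chi g * a) x = 0] for all [h], whence every
    [chi g * a] vanishes, and among them [chi 1 * a = a]
    ([Phi_matrix_unit_inj]).  If the matrix is singular, the orthogonality relations for the characters [chi g] of
    [G], in characteristic 0, provide [g != 1] with [chi g] trivial on [G]; then
    [chi g - chi 1] is [G]-invariant and its image [g - 1] is in [I]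
    ([nondeg_Phi_matrix], [Phi_inj_nondeg]). *)

(** * Contractions and permutations of tensor factors *)

Section Multilinear.
Variable k : fieldType.
Implicit Types U V W : vectType k.

Lemma tensDl U V (u u' : U) (v : V) : (u + u') ⊗ v = u ⊗ v + u' ⊗ v.
Proof. by have := tensPl v 1 u u'; rewrite /= !scale1r. Qed.

Lemma tensDr U V (u : U) (v v' : V) : u ⊗ (v + v') = u ⊗ v + u ⊗ v'.
Proof. by have := tensPr u 1 v v'; rewrite /= !scale1r. Qed.

Lemma tensZl U V c (u : U) (v : V) : (c *: u) ⊗ v = c *: (u ⊗ v).
Proof. by have := tensPl v c u 0; rewrite /= tens0l !addr0. Qed.

Lemma tensZr U V c (u : U) (v : V) : u ⊗ (c *: v) = c *: (u ⊗ v).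
Proof.
have u0 : u ⊗ (0 : V) = 0 by apply: (addrI (u ⊗ 0)); rewrite -tensDr !addr0.
by have := tensPr u c v 0; rewrite /= u0 !addr0.
Qed.

(** Slicing by a functional; [Phi R a] is [contrl a] of the monodromy element
    [tswap R * R]. *)
Definition contrl U V (a : 'Hom(U, k^o)) : U ⊗ V -> V :=
  tlift (fun u v => a u *: v).
Definition contrr U V (b : 'Hom(V, k^o)) : U ⊗ V -> U :=
  tlift (fun u v => b v *: u).
HB.instance Definition _ U V a := GRing.Linear.on (@contrl U V a).
HB.instance Definition _ U V b := GRing.Linear.on (@contrr U V b).

Lemma contrlE U V (a : 'Hom(U, k^o)) (u : U) (v : V) :
  contrl a (u ⊗ v) = a u *: v.
Proof.
apply: tliftE; split=> [w|w] c x y; first by rewrite linearP scalerDl -scalerA.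
by rewrite scalerDr !scalerA mulrC.
Qed.

Lemma contrrE U V (b : 'Hom(V, k^o)) (u : U) (v : V) :
  contrr b (u ⊗ v) = b v *: u.
Proof.
apply: tliftE; split=> [w|w] c x y; last by rewrite linearP scalerDl -scalerA.
by rewrite scalerDr !scalerA mulrC.
Qed.

Lemma contrlr U V (a : 'Hom(U, k^o)) (b : 'Hom(V, k^o)) (t : U ⊗ V) :
  a (contrr b t) = b (contrl a t).
Proof.
elim/tens_ind: t => [u v|s t IHs IHt]; last by rewrite !linearD /= IHs IHt.
by rewrite contrlE contrrE !linearZ /= [LHS]mulrC.
Qed.

Lemma dual_separates U (x y : U) : (forall a : 'Hom(U, k^o), a x = a y) -> x = y.
Proof.
move=> xy; rewrite (coord_vbasis (memvf x)) (coord_vbasis (memvf y)).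
apply: eq_bigr => i _; congr (_ *: _).
by have := xy (linfun (coord (vbasis {:U}) i : {linear U -> k^o})); rewrite !lfunE.
Qed.

Lemma lker0_bij (U V : vectType k) (f : 'Hom(U, V)) :
  \dim {:U} = \dim {:V} -> lker f = 0%VS -> bijective f.
Proof.
move=> dUV /eqP kf; have imf : limg f = fullv.
  by apply/eqP; rewrite eqEdim subvf -dUV limg_dim_eq ?leqnn // (eqP kf) capv0.
exists (f^-1)%VF => [|y]; first exact: lker0_lfunK.
by apply: limg_lfunVK; rewrite imf memvf.
Qed.

(** The cyclic rotation carries each of the three embeddings of [H ⊗ H] to
    another one, and so turns the hexagon axioms for [R] into coproduct formulas
    for [tswap R]. *)
Definition trot U V W : U ⊗ V ⊗ W -> V ⊗ W ⊗ U :=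
  tlift (fun s w => tlift (fun u v => v ⊗ w ⊗ u) s).
HB.instance Definition _ U V W := GRing.Linear.on (@trot U V W).

Lemma trotE U V W (u : U) (v : V) (w : W) : trot (u ⊗ v ⊗ w) = v ⊗ w ⊗ u.
Proof.
rewrite /trot tliftE; last first.
  split=> [x|x]; first exact: tlift_linear.
  by apply: tlift_param => u' v' c y z; rewrite tensPr tensPl.
by apply: tliftE; split=> [x|x] c y z; rewrite ?tensPr ?tensPl.
Qed.

Lemma tens3_ind U V W (P : U ⊗ V ⊗ W -> Prop) :
  (forall u v w, P (u ⊗ v ⊗ w)) -> (forall s t, P s -> P t -> P (s + t)) ->
  forall t, P t.
Proof.
move=> Pp Pa; elim/tens_ind=> // s w; elim/tens_ind: s => // s t Ps Pt.
by rewrite tensDl; apply: Pa.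
Qed.

Lemma tmapM (A B A' B' : falgType k) (f : {linear A -> A'})
    (g : {linear B -> B'}) :
  {morph f : x y / x * y} -> {morph g : x y / x * y} ->
  {morph tmap f g : s t / s * t}.
Proof.
move=> fM gM; elim/tens_ind=> [a b|s s' IH IH'] t; last first.
  by rewrite mulrDl !linearD /= mulrDl IH IH'.
elim/tens_ind: t => [c d|s s' IH IH']; last first.
  by rewrite mulrDr !linearD /= mulrDr IH IH'.
by rewrite tensM !tmapE tensM fM gM.
Qed.

Lemma tens3r_ind U V W (P : U ⊗ (V ⊗ W) -> Prop) :
  (forall u v w, P (u ⊗ (v ⊗ w))) -> (forall s t, P s -> P t -> P (s + t)) ->
  forall t, P t.
Proof.
move=> Pp Pa; elim/tens_ind=> // u s; elim/tens_ind: s => // s t Ps Pt.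
by rewrite tensDr; apply: Pa.
Qed.

Lemma tassocM (A B C : falgType k) : {morph @tassoc k A B C : s t / s * t}.
Proof.
elim/tens3r_ind=> [a b c|s s' IH IH'] t; last first.
  by rewrite mulrDl !linearD /= mulrDl IH IH'.
elim/tens3r_ind: t => [x y z|s s' IH IH']; last first.
  by rewrite mulrDr !linearD /= mulrDr IH IH'.
by rewrite !(tensM, tassocE).
Qed.

Lemma tswap_tmap U V U' V' (f : {linear U -> U'}) (g : {linear V -> V'}) t :
  tswap (tmap f g t) = tmap g f (tswap t).
Proof.
elim/tens_ind: t => [u v|s t IHs IHt]; last by rewrite !linearD /= IHs IHt.
by rewrite tmapE !tswapE tmapE.
Qed.

Lemma trotM (A B C : falgType k) : {morph @trot A B C : s t / s * t}.
Proof.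
elim/tens3_ind=> [a b c|s s' IH IH'] t; last first.
  by rewrite mulrDl !linearD /= mulrDl IH IH'.
elim/tens3_ind: t => [x y z|s s' IH IH']; last first.
  by rewrite mulrDr !linearD /= mulrDr IH IH'.
by rewrite !(tensM, trotE).
Qed.

Lemma trot_tassoc U V W (u : U) (t : V ⊗ W) : trot (tassoc (u ⊗ t)) = t ⊗ u.
Proof.
elim/tens_ind: t => [v w|s t IHs IHt]; first by rewrite tassocE trotE.
by rewrite tensDr tensDl !linearD /= IHs IHt.
Qed.

Lemma trot2 U V W (t : U ⊗ V) (w : W) : trot (trot (t ⊗ w)) = tassoc (w ⊗ t).
Proof.
elim/tens_ind: t => [u v|s t IHs IHt]; first by rewrite !trotE tassocE.
by rewrite tensDr tensDl !linearD /= IHs IHt.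
Qed.

End Multilinear.

(** * The three embeddings of [H ⊗ H] into [H ⊗ H ⊗ H] *)

Section Legs.
Variables (k : fieldType) (H : hopfAlgType k).
Implicit Types s t : H ⊗ H.

HB.instance Definition _ := GRing.isSemilinear.Build k (H ⊗ H)%type
  (H ⊗ H ⊗ H)%type _ (@leg12 k H) (GRing.semilinear_linear (tlift_linear _)).
HB.instance Definition _ := GRing.isSemilinear.Build k (H ⊗ H)%type
  (H ⊗ H ⊗ H)%type _ (@leg13 k H) (GRing.semilinear_linear (tlift_linear _)).
HB.instance Definition _ := GRing.isSemilinear.Build k (H ⊗ H)%type
  (H ⊗ H ⊗ H)%type _ (@leg23 k H) (GRing.semilinear_linear (tlift_linear _)).

Lemma leg12E s : leg12 s = s ⊗ 1.
Proof.
elim/tens_ind: s => [a b|s t IHs IHt]; last by rewrite linearD tensDl /= IHs IHt.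
by apply: tliftE; split=> [v|u] c x y; rewrite !(tensPl, tensPr).
Qed.

Lemma leg13E a b : leg13 (a ⊗ b) = a ⊗ 1 ⊗ b :> H ⊗ H ⊗ H.
Proof. by apply: tliftE; split=> [v|u] c x y; rewrite !(tensPl, tensPr). Qed.

Lemma leg23E s : leg23 s = tassoc (1 ⊗ s).
Proof.
elim/tens_ind: s => [a b|s t IHs IHt]; last first.
  by rewrite tensDr !linearD /= IHs IHt.
by rewrite tassocE; apply: tliftE; split=> [v|u] c x y; rewrite !(tensPl, tensPr).
Qed.

Lemma leg13M : {morph @leg13 k H : s t / s * t}.
Proof.
elim/tens_ind=> [a b|s s' IH IH'] t; last first.
  by rewrite mulrDl !linearD /= mulrDl IH IH'.
elim/tens_ind: t => [c d|s s' IH IH']; last first.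
  by rewrite mulrDr !linearD /= mulrDr IH IH'.
by rewrite tensM !leg13E !tensM mulr1.
Qed.

Lemma trot_leg12 s : trot (leg12 s) = leg13 (tswap s).
Proof.
elim/tens_ind: s => [a b|s t IHs IHt]; last by rewrite !linearD /= IHs IHt.
by rewrite leg12E trotE tswapE leg13E.
Qed.

Lemma trot_leg13 s : trot (leg13 s) = leg23 (tswap s).
Proof.
elim/tens_ind: s => [a b|s t IHs IHt]; last by rewrite !linearD /= IHs IHt.
by rewrite leg13E trotE tswapE leg23E tassocE.
Qed.

Lemma trot_leg23 s : trot (leg23 s) = leg12 s.
Proof. by rewrite leg23E trot_tassoc leg12E. Qed.

Lemma contrl_leg13 (a : 'Hom(H, k^o)) t :
  tmap (contrl a) idfun (leg13 t) = 1 ⊗ contrl a t.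
Proof.
elim/tens_ind: t => [x y|s t IHs IHt]; last by rewrite !linearD /= tensDr IHs IHt.
by rewrite leg13E tmapE /= !contrlE tensZl tensZr.
Qed.

(** Slicing the first factor is a bimodule map over the algebra carried by the
    other two. *)
Lemma contrl_leg23M (a : 'Hom(H, k^o)) s (t : H ⊗ H ⊗ H) s' :
  tmap (contrl a) idfun (leg23 s * t * leg23 s')
  = s * tmap (contrl a) idfun t * s'.
Proof.
elim/tens_ind: s => [x y|s u IHs IHu]; last first.
  by rewrite !linearD /= !mulrDl !linearD /= IHs IHu.
elim/tens_ind: s' => [z w|s' u IHs IHu]; last first.
  by rewrite !linearD /= !mulrDr !linearD /= IHs IHu.
elim/tens3_ind: t => [u v r|t u IHt IHu]; last first.
  by rewrite !(mulrDr, mulrDl, linearD) /= IHt IHu.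
rewrite !leg23E !tassocE !tensM !tmapE /= !contrlE mul1r mulr1.
by rewrite !tensZl -scalerAr -scalerAl !tensM.
Qed.

Lemma contrr_leg13 (b : 'Hom(H, k^o)) t : contrr b (leg13 t) = contrr b t ⊗ 1.
Proof.
elim/tens_ind: t => [x y|s t IHs IHt]; last by rewrite !linearD /= tensDl IHs IHt.
by rewrite leg13E !contrrE tensZl.
Qed.

Lemma contrr_leg12M (b : 'Hom(H, k^o)) s (t : H ⊗ H ⊗ H) s' :
  contrr b (leg12 s * t * leg12 s') = s * contrr b t * s'.
Proof.
elim/tens_ind: t => [u v|t u IHt IHu]; last first.
  by rewrite !(mulrDr, mulrDl, linearD) /= IHt IHu.
by rewrite !leg12E !tensM mul1r mulr1 !contrrE -scalerAr -scalerAl.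
Qed.

End Legs.

Lemma Phi_contrl (k : fieldType) (H : hopfAlgType k) (R : H ⊗ H)
    (a : 'Hom(H, k^o)) : Phi R a = contrl a (tswap R * R).
Proof. exact: PhiE. Qed.

(** * The Drinfeld map and the central elements *)

(** The action of [c : H^*] on [H], which is transpose to the convolution
    product: [a \o hit c] is the product [c * a] in [H^*]. *)
Definition hit (k : fieldType) (H : hopfAlgType k) (c : 'Hom(H, k^o)) : 'End(H) :=
  linfun (contrl c \o comul).

Section DrinfeldMap.
Variables (k : fieldType) (H : hopfAlgType k) (R : H ⊗ H).
Hypothesis qtR : quasitriangular R.
Local Notation Q := (tswap R * R).

(** The two outer factors come from the hexagon axioms for [tswap R] and for
    [R]; the two inner ones, both in positions 1 and 3, combine into [Q]. *)
Lemma comul_monodromyl :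
  tmap comul idfun Q = leg23 (tswap R) * leg13 Q * leg23 R.
Proof.
case: qtR => _ DR RD _.
have DswapR : tmap comul idfun (tswap R) = leg23 (tswap R) * leg13 (tswap R).
  rewrite -trot_leg13 -trot_leg12 -trotM -RD.
  elim/tens_ind: (R) => [a b|s t IHs IHt]; last by rewrite !linearD /= IHs IHt.
  by rewrite tswapE !tmapE trot_tassoc.
have DM := tmapM (g := idfun : {linear H -> H}) (@comulM k H) (fun _ _ => erefl).
by rewrite DM DswapR DR leg13M !mulrA.
Qed.

Lemma comul_monodromyr :
  tassoc (tmap idfun comul Q) = leg12 (tswap R) * leg13 Q * leg12 R.
Proof.
case: qtR => _ DR RD _.
have DswapR : tassoc (tmap idfun comul (tswap R))
    = leg12 (tswap R) * leg13 (tswap R).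
  (* two rotations are the inverse rotation, which moves the last factor first *)
  rewrite -trot_leg12 -!trot_leg23 -trot_leg13 -!trotM -DR.
  elim/tens_ind: (R) => [a b|s t IHs IHt]; last by rewrite !linearD /= IHs IHt.
  by rewrite tswapE !tmapE /= trot2.
have DM := tmapM (f := idfun : {linear H -> H}) (fun _ _ => erefl) (@comulM k H).
by rewrite DM tassocM DswapR RD leg13M !mulrA.
Qed.

(** Slicing the first factor of [R_32 Q_13 R_23] by [c] leaves
    [R_21 (1 ⊗ Phi R c) R]; a central [Phi R c] can be pulled out of it, which
    leaves [(1 ⊗ Phi R c) Q]. *)
Lemma Phi_hit (c a : 'Hom(H, k^o)) : (forall y, Phi R c * y = y * Phi R c) ->
  Phi R (a \o hit c)%VF = Phi R c * Phi R a.
Proof.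
move=> cC; transitivity (contrl a (tmap (contrl c) idfun (tmap comul idfun Q))).
  rewrite Phi_contrl; elim/tens_ind: (Q) => [x y|s t IHs IHt]; last first.
    by rewrite !linearD /= IHs IHt.
  by rewrite !tmapE !contrlE comp_lfunE lfunE.
rewrite comul_monodromyl contrl_leg23M contrl_leg13 -Phi_contrl.
move: (Phi R c) cC => z zC.
have -> : tswap R * (1 ⊗ z) = (1 ⊗ z) * tswap R.
  elim/tens_ind: (tswap R) => [x y|s t IHs IHt].
    by rewrite !tensM mul1r mulr1 zC.
  by rewrite mulrDl mulrDr IHs IHt.
rewrite -mulrA Phi_contrl; elim/tens_ind: (Q) => [x y|s t IHs IHt].
  by rewrite tensM mul1r !contrlE scalerAr.
by rewrite !(mulrDr, linearD) /= IHs IHt.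
Qed.

(** The mirror image of [Phi_hit]: slicing the third factor of
    [R_21 Q_13 R_12] by [b] leaves [R_21 (h ⊗ 1) R], which is [(h ⊗ 1) Q]
    because [h] is central. *)
Lemma Phi_amull (a b : 'Hom(H, k^o)) h : contrr b Q = h ->
  (forall y, h * y = y * h) ->
  Phi R (a \o amull h)%VF = contrr b (comul (Phi R a)).
Proof.
move=> bh hC.
transitivity (contrl a (contrr b (tassoc (tmap idfun comul Q)))); last first.
  rewrite Phi_contrl; elim/tens_ind: (Q) => [x y|s t IHs IHt]; last first.
    by rewrite !linearD /= IHs IHt.
  rewrite tmapE contrlE !linearZ /=.
  elim/tens_ind: (comul y) => [u v|s t IHs IHt].
    by rewrite tassocE !contrrE linearZ /= contrlE !scalerA mulrC.
  by rewrite tensDr !linearD /= IHs IHt.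
rewrite comul_monodromyr contrr_leg12M contrr_leg13 bh.
have -> : tswap R * (h ⊗ 1) = (h ⊗ 1) * tswap R.
  elim/tens_ind: (tswap R) => [x y|s t IHs IHt].
    by rewrite !tensM mul1r mulr1 hC.
  by rewrite mulrDl mulrDr IHs IHt.
rewrite -mulrA Phi_contrl; elim/tens_ind: (Q) => [x y|s t IHs IHt].
  by rewrite tensM mul1r !contrlE comp_lfunE lfunE.
by rewrite !(mulrDr, linearD) /= IHs IHt.
Qed.

Hypothesis bijR : bijective (Phi R).

Lemma lker_Phi : lker (Phi R) == 0%VS.
Proof. by apply/lker0P; apply: bij_inj. Qed.

Lemma limg_Phi : limg (Phi R) = fullv.
Proof.
apply/vspaceP=> y; rewrite memvf; apply/memv_imgP.
by case: bijR => f _ fK; exists (f y); rewrite ?memvf ?fK.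
Qed.

Lemma PhiK : cancel (Phi R) (Phi R)^-1%VF.
Proof. exact/lker0_lfunK/lker_Phi. Qed.

Lemma PhiVK : cancel (Phi R)^-1%VF (Phi R).
Proof. by move=> y; apply: limg_lfunVK; rewrite limg_Phi memvf. Qed.

(** The preimage of [h] under the transpose of [Phi R], that is, under
    [b |-> (id ⊗ b) Q]. *)
Definition dualPhiV (h : H) : 'Hom(H, k^o) :=
  linfun ((fun a : 'Hom(H, k^o) => a h) \o (Phi R)^-1%VF).

Lemma dualPhiVE h y : dualPhiV h y = (Phi R)^-1%VF y h.
Proof.
pose f x : k^o := (Phi R)^-1%VF x h.
have lf : linear f by move=> c x z; rewrite /f linearP add_lfunE scale_lfunE.
pose fL : {linear H -> k^o} :=
  HB.pack f (GRing.isSemilinear.Build k H k^o _ f (GRing.semilinear_linear lf)).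
exact: (lfunE fL).
Qed.

Lemma contrr_dualPhiV h : contrr (dualPhiV h) Q = h.
Proof.
by apply: dual_separates => a; rewrite contrlr -Phi_contrl dualPhiVE PhiK.
Qed.

(** This is where both sides of the pairing meet: for [c] the preimage of [g],
    the functional [c (h * _)] is sent by [Phi R] to [(id ⊗ b)(comul g)] with
    [b] the dual preimage of [h], and that is [b g *: g] as [g] is group-like. *)
Lemma PhiV_mull g h x : grouplike g -> (forall y, h * y = y * h) ->
  (Phi R)^-1%VF g (h * x) = (Phi R)^-1%VF g h * (Phi R)^-1%VF g x.
Proof.
move=> gl hC; set c := (Phi R)^-1%VF g.
suff /lfunP/(_ x) : (c \o amull h = c h *: c)%VF.
  by rewrite comp_lfunE lfunE scale_lfunE.
apply: (bij_inj bijR); rewrite (Phi_amull c (contrr_dualPhiV h) hC) linearZ /= PhiVK.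
by rewrite comul_grouplike // contrrE dualPhiVE.
Qed.

End DrinfeldMap.

(** * Passing to a quotient Hopf algebra *)

Section QuotientQuasitriangular.
Variables (k : fieldType) (H : hopfAlgType k) (I : hopf_ideal H).
Local Notation pi := (hquot_pi I).

Lemma comul_hquot x : comul (pi x) = tmap pi pi (comul x).
Proof. exact: hquot_comulE. Qed.

Lemma quasitriangular_hquot (R : H ⊗ H) :
  quasitriangular R -> quasitriangular (tmap pi pi R).
Proof.
pose pi3 := tmap (tmap pi pi) pi : H ⊗ H ⊗ H -> _.
have pi2M := tmapM (@hquot_piM _ _ I) (@hquot_piM _ _ I).
have pi3M : {morph pi3 : s t / s * t}.
  exact: tmapM pi2M (@hquot_piM _ _ I).
have pi3E x y z : pi3 (x ⊗ y ⊗ z) = pi x ⊗ pi y ⊗ pi z.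
  by rewrite /pi3 tmapE /= tmapE.
have leg12_pi s : leg12 (tmap pi pi s) = pi3 (leg12 s).
  by rewrite !leg12E /pi3 tmapE.
have leg13_pi s : leg13 (tmap pi pi s) = pi3 (leg13 s).
  elim/tens_ind: s => [x y|s t IHs IHt]; first by rewrite tmapE !leg13E pi3E.
  by rewrite /pi3 !linearD /= IHs IHt.
have leg23_pi s : leg23 (tmap pi pi s) = pi3 (leg23 s).
  rewrite !leg23E; elim/tens_ind: s => [x y|s t IHs IHt].
    by rewrite tmapE !tassocE pi3E.
  by rewrite /pi3 !(linearD, tensDr) /= IHs IHt.
case=> /unitrP[R' [R'R RR']] DR RD Rcomm; split.
- by apply/unitrP; exists (tmap pi pi R'); rewrite -!pi2M R'R RR' tmap_pi1.
- rewrite leg13_pi leg23_pi -pi3M -DR /pi3.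
  elim/tens_ind: (R) => [x y|s t IHs IHt]; last by rewrite !linearD /= IHs IHt.
  by rewrite !tmapE /= comul_hquot.
- rewrite leg13_pi leg12_pi -pi3M -RD.
  elim/tens_ind: (R) => [x y|s t IHs IHt].
    rewrite !tmapE /= comul_hquot; elim/tens_ind: (comul y) => [u v|s t IHs IHt].
      by rewrite tmapE !tassocE pi3E.
    by rewrite /pi3 !(linearD, tensDr) /= IHs IHt.
  by rewrite /pi3 !linearD /= IHs IHt.
by elim/hquot_ind=> x; rewrite comul_hquot -pi2M -Rcomm pi2M -tswap_tmap.
Qed.

Lemma Phi_hquot (R : H ⊗ H) (a : 'Hom(hquot I, k^o)) :
  Phi (tmap pi pi R) a = pi (Phi R (a \o pi)%VF).
Proof.
rewrite !Phi_contrl tswap_tmap -(tmapM (@hquot_piM _ _ I) (@hquot_piM _ _ I)).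
elim/tens_ind: (_ * R) => [u v|s t IHs IHt]; last by rewrite !linearD /= IHs IHt.
by rewrite tmapE !contrlE comp_lfunE linearZ.
Qed.

(** Functionals on [H / I] are the functionals on [H] that vanish on [I], and
    the Drinfeld map of the quotient is then [Phi R] read modulo [I]; as its
    source and target have equal dimensions, only injectivity is at stake. *)
Lemma Phi_hquot_bijP (R : H ⊗ H) :
  bijective (Phi (tmap pi pi R)) <->
  (forall a : 'Hom(H, k^o), (I <= lker a)%VS -> Phi R a \in (I : {vspace H}) ->
     a = 0).
Proof.
have pi0 x : (pi x == 0) = (x \in (I : {vspace H})).
  by rewrite -memv_ker lker_vquot_pi.
split=> [/bij_inj injPhi a aI PhiaI|PhiI].
  (* [a] factors through the quotient since it vanishes on [I] *)
  have aE : a = (a \o pi^-1 \o pi)%VF.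
    apply/lfunP=> x; rewrite !comp_lfunE; apply/esym/subr0_eq.
    rewrite -linearB; apply/eqP; rewrite -memv_ker; apply: (subvP aI).
    by rewrite -pi0 linearB /= limg_lfunVK ?subrr // limg_vquot_pi memvf.
  rewrite aE; suff -> : (a \o pi^-1)%VF = 0 by rewrite comp_lfun0l.
  by apply: injPhi; rewrite Phi_hquot -aE linear0; apply/eqP; rewrite pi0.
apply: lker0_bij; first by rewrite !dimvf /dim /= muln1.
apply/eqP; rewrite -subv0; apply/subvP=> a; rewrite memv_ker Phi_hquot pi0 => Ia.
have /PhiI/(_ Ia) a0 : (I <= lker (a \o pi))%VS.
  apply/subvP=> x; rewrite -pi0 memv_ker comp_lfunE => /eqP->.
  by rewrite linear0.
rewrite memv0; apply/eqP/lfunP; elim/hquot_ind=> x.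
by have /lfunP/(_ x) := a0; rewrite comp_lfunE !zero_lfunE.
Qed.

End QuotientQuasitriangular.

(** * The pairing on a central subgroup *)

Section CentralGrouplike.
Variables (k : fieldType) (H : hopfAlgType k).
Implicit Types (c : 'Hom(H, k^o)) (g h x : H).

Lemma hit_grouplike_mull c h x : grouplike h ->
  (forall y, c (h * y) = c h * c y) -> hit c (h * x) = (c h : k) *: (h * hit c x).
Proof.
move=> gl ch; rewrite !lfunE /= comulM comul_grouplike //.
elim/tens_ind: (comul x) => [u v|s t IHs IHt].
  by rewrite tensM !contrlE ch -scalerAr scalerA.
by rewrite !(mulrDr, linearD) /= IHs IHt.
Qed.

Lemma hit_grouplike c h : grouplike h -> hit c h = (c h : k) *: h.
Proof. by move=> gl; rewrite lfunE /= comul_grouplike // contrlE. Qed.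

Lemma counit_hit c : (counit \o hit c)%VF = c.
Proof.
apply/lfunP=> x; rewrite comp_lfunE lfunE /= -contrlr.
congr (c _); exact: comul_counit.
Qed.

End CentralGrouplike.

Lemma sum_enum_val (T : finType) (V : nmodType) (F : T -> V) :
  \sum_(i < #|{: T}|) F (enum_val i) = \sum_x F x.
Proof. by rewrite [RHS](reindex _ (onW_bij _ (@enum_val_bij T))). Qed.

Section CentralSubgroup.
Variables (k : fieldType) (H : hopfAlgType k) (R : H ⊗ H).
Hypothesis HR : factorizable R.
Variables (G : {fset H}) (hG : central_subgroup G).
Local Notation I := (aug_hopf_ideal hG).
Local Notation chi := (Phi R)^-1%VF.

Let qtR : quasitriangular R. Proof. by case: HR. Qed.
Let bijR : bijective (Phi R). Proof. by case: HR. Qed.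
Let gl g : g \in G -> grouplike g := @central_subgroup_grouplike _ _ _ hG g.

Lemma central_subgroupC g : g \in G -> forall y, g * y = y * g.
Proof.
move=> Gg y; have := central_subgroup_center hG Gg.
by rewrite memv_cap => /andP[_ /centvP]; apply; apply: memvf.
Qed.
Let gC := central_subgroupC.

(** With [a = chi g'], this makes [chi] multiplicative from [G] to the
    convolution algebra [H^*]. *)
Lemma PhiV_hit g a : g \in G -> (a \o hit (chi g))%VF = chi (g * Phi R a).
Proof.
move=> Gg; apply: (bij_inj bijR); rewrite (Phi_hit qtR) !PhiVK // => y.
exact: gC.
Qed.

Lemma PhiV1 : chi 1 = counit.
Proof.
rewrite -[LHS]counit_hit PhiV_hit ?(central_subgroup1 hG) // mul1r.
exact: PhiK.
Qed.

Lemma PhiV_grouplikeMl g g' h : g \in G -> g' \in G -> h \in G ->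
  chi (g * g') h = chi g h * chi g' h.
Proof.
move=> Gg Gg' Gh; rewrite -[g' in LHS](PhiVK bijR) -PhiV_hit //.
by rewrite comp_lfunE hit_grouplike ?gl // linearZ.
Qed.

Lemma PhiV_grouplikeMr g h x : g \in G -> h \in G ->
  chi g (h * x) = chi g h * chi g x.
Proof. by move=> Gg Gh; apply: PhiV_mull; rewrite ?gl //; apply: gC. Qed.

Lemma sum_subgroup_mulr (V : nmodType) (F : H -> V) h : h \in G ->
  \sum_(g : G) F (val g * h) = \sum_(g : G) F (val g).
Proof.
move=> Gh; pose m (g : G) : G := [` central_subgroupM hG (valP g) Gh]%fset.
have m_inj : injective m.
  move=> g g' /(congr1 val)/(mulIr (grouplike_unit (gl Gh)))/val_inj //.
by rewrite [RHS](reindex_inj m_inj).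
Qed.

(** The sum of the elements of [G] is an integral of the group algebra. *)
Lemma sum_mul_aug_ideal y : y \in aug_ideal G -> \sum_(g : G) val g * y = 0.
Proof.
pose N := \sum_(g : G) val g; rewrite -mulr_suml -/N.
suff /subvP sI : (aug_ideal G <= lker (amull N))%VS.
  by move=> /sI; rewrite memv_ker lfunE => /eqP.
apply: (aug_ideal_sub hG) => g x Gg; rewrite memv_ker lfunE /= mulrBr.
by rewrite -(gC Gg) mulrA {1}/N mulr_suml (sum_subgroup_mulr id Gg) subrr.
Qed.

(** As [Phi R a] lies in the ideal, [\sum_g g * Phi R a = 0], so the convolution
    products [chi g * a] sum to [0].  At [h * x], with [h] in [G], the product
    [chi g * a] takes its value at [x] multiplied by [chi g h], since [a] is
    [G]-invariant: the row of the values at [x] is killed by the invertible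
    matrix, and its entry at [g = 1] is [a x]. *)
Lemma Phi_matrix_unit_inj : Phi_matrix R G \in unitmx ->
  forall a : 'Hom(H, k^o), (I <= lker a)%VS -> Phi R a \in (I : {vspace H}) ->
  a = 0.
Proof.
move=> Mu a aI PhiaI.
have aM g x : g \in G -> a (g * x) = a x.
  move=> Gg; apply/eqP; rewrite -subr_eq0 -linearB -memv_ker.
  by apply: (subvP aI); rewrite gC // mem_aug_ideal.
have v0 x : \row_(i < #|{: G}|) (a (hit (chi (val (enum_val i))) x) : k) = 0.
  rewrite -[LHS]mulmx1 -(mulmxV Mu) mulmxA [X in X *m _](_ : _ = 0) ?mul0mx //.
  apply/rowP=> j; rewrite !mxE; set h := val (enum_val j).
  have Gh : h \in G by apply: valP.
  transitivity ((\sum_(g : G) chi (val g * Phi R a)) (h * x)).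
    rewrite sum_lfunE -[RHS]sum_enum_val.
    apply: eq_bigr => i _; rewrite !mxE -/h; set g := val _.
    have Gg : g \in G by apply: valP.
    rewrite -PhiV_hit // comp_lfunE hit_grouplike_mull ?gl //; last first.
      by move=> y; apply: PhiV_grouplikeMr.
    by rewrite linearZ /= aM // mulrC.
  by rewrite -linear_sum sum_mul_aug_ideal // linear0 zero_lfunE.
have G1 := central_subgroup1 hG; apply/lfunP=> x; rewrite zero_lfunE.
have /rowP/(_ (enum_rank [` G1]%fset)) := v0 x; rewrite !mxE enum_rankK /=.
by rewrite -comp_lfunE PhiV_hit // mul1r PhiK.
Qed.

(** If [chi g] is trivial on [G], then [chi g - chi 1] vanishes on the ideal,
    while its image [g - 1] lies in the ideal. *)
Lemma Phi_inj_nondeg :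
  (forall a : 'Hom(H, k^o), (I <= lker a)%VS -> Phi R a \in (I : {vspace H}) ->
     a = 0) ->
  forall g, g \in G -> (forall h, h \in G -> chi g h = 1) -> g = 1.
Proof.
move=> inj g Gg g1; have G1 := central_subgroup1 hG.
suff /(congr1 (Phi R)) : chi g - chi 1 = 0.
  by rewrite linearB /= !PhiVK // linear0 => /subr0_eq.
apply: inj.
  apply: (aug_ideal_sub hG) => h x Gh; rewrite memv_ker linearB /= -gC //.
  rewrite !add_lfunE !opp_lfunE !PhiV_grouplikeMr // g1 // PhiV1.
  by rewrite counit_grouplike ?gl // !mul1r subrr.
by rewrite linearB /= !PhiVK // -[g]mul1r mem_aug_ideal.
Qed.

(** Orthogonality of the characters [chi g] of [G]: the inverse of the matrix is,
    up to the factor [#|G|], the matrix with entries [chi g^-1 h], transposed. *)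
Lemma nondeg_Phi_matrix : [pchar k] =i pred0 ->
  (forall g, g \in G -> (forall h, h \in G -> chi g h = 1) -> g = 1) ->
  Phi_matrix R G \in unitmx.
Proof.
move=> char_k nondeg; have G1 := central_subgroup1 hG.
pose n := #|{: G}|.
pose M' : 'M[k]_n :=
  \matrix_(i, j) chi (val (enum_val j))^-1 (val (enum_val i)).
have sum_chi g : g \in G ->
    \sum_(h : G) chi g (val h) = (n * (g == 1))%:R.
  move=> Gg; have [->|g1] := eqVneq g 1.
    rewrite muln1 PhiV1 (eq_bigr (fun=> 1)) ?sumr_const // => h _.
    by apply/counit_grouplike/gl/valP.
  rewrite muln0; have [h0 /andP[Gh0 gh0]] : exists h, (h \in G) && (chi g h != 1).
    pose P (h : G) := chi g (val h) != 1.
    have [/existsP[h Ph]|noP] := boolP [exists h, P h].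
      exists (val h); apply/andP; split; [exact: valP | exact: Ph].
    case/eqP: g1; apply: nondeg => // h Gh; move: noP.
    by rewrite negb_exists => /forallP/(_ [` Gh]%fset); rewrite negbK => /eqP.
  (* translating by [h0] multiplies the sum by [chi g h0], which is not 1 *)
  set S := LHS; have : chi g h0 * S = S.
    rewrite /S mulr_sumr -[RHS](sum_subgroup_mulr (chi g) Gh0).
    apply: eq_bigr => h _; rewrite -PhiV_grouplikeMr // gC //.
  move/eqP; rewrite -subr_eq0 -{2}[S]mul1r -mulrBl mulf_eq0 subr_eq0.
  by rewrite (negPf gh0) => /eqP.
have Gi (i : 'I_n) : val (enum_val i : G) \in G by apply: valP.
have Ui (i : 'I_n) : val (enum_val i : G) \is a GRing.unit.
  exact/grouplike_unit/gl/Gi.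
have MM' : Phi_matrix R G *m M' = n%:R%:M.
  apply/matrixP=> i j; rewrite !mxE.
  transitivity (\sum_(h : G) chi (val (enum_val i) / val (enum_val j)) (val h)).
    rewrite -[RHS]sum_enum_val; apply: eq_bigr => l _; rewrite !mxE.
    by rewrite -PhiV_grouplikeMl // (central_subgroupV hG).
  rewrite sum_chi ?(central_subgroupM hG) ?(central_subgroupV hG) //.
  rewrite natrM -[RHS]mulr_natr; congr (_ * (nat_of_bool _)%:R).
  apply/eqP/eqP=> [ij|->]; last by rewrite divrr.
  by apply/enum_val_inj/val_inj/(divIr (Ui j)); rewrite ij divrr.
have n0 : n%:R != 0 :> k.
  have /pcharf0P -> := char_k; rewrite -lt0n.
  by apply/card_gt0P; exists [` G1]%fset.
by case: (@mulmx1_unit _ _ (Phi_matrix R G) (n%:R^-1 *: M'));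
   rewrite // -scalemxAr MM' scale_scalar_mx mulVf.
Qed.

End CentralSubgroup.

Theorem lemma3p1 (k : closedFieldType) (char_k : [pchar k] =i pred0)
    (H : hopfAlgType k) (R : (H ⊗ H)%type) (HR : factorizable R)
    (G : {fset H}) (hG : central_subgroup G) :
  factorizable (tmap (hquot_pi (aug_hopf_ideal hG))
                     (hquot_pi (aug_hopf_ideal hG)) R) <->
  Phi_matrix R G \in unitmx.
Proof.
split=> [[_ /Phi_hquot_bijP inj]|Mu].
  exact/(nondeg_Phi_matrix HR hG char_k)/(Phi_inj_nondeg HR inj).
split; first by apply: quasitriangular_hquot; case: HR.
exact/Phi_hquot_bijP/(Phi_matrix_unit_inj HR).
Qed.
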